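(* Let $A:=k[x]/\langle x^m\rangle$ and let $P_1,\dots,P_{n-1}$ be elements (polynomials) of $A$ such that $x$ divides $P_j$ in $A$ for all $j$. Then there exists a unique upper triangular twisting map $s_n\colon C_n\otimes A\to A\otimes C_n$ with $\gamma^1_j(x)=P_j$ for each $j=1,\dots,n-1$.
   Context: $k$ is a commutative ring; all algebras are associative unital $k$-algebras, all maps are $k$-linear and $\otimes$ means $\otimes_k$. $m,n\ge 1$ are integers and $C_n:=k[y]/\langle y^n\rangle$. A twisting map is a $k$-linear map $s\colon C_n\otimes A\to A\otimes C_n$ such that (1) $s(1\otimes a)=a\otimes 1$ and $s(c\otimes 1)=1\otimes c$; (2) $s\circ(\mu_{C_n}\otimes A)=(A\otimes\mu_{C_n})\circ(s\otimes C_n)\circ(C_n\otimes s)$; (3) $s\circ(C_n\otimes\mu_A)=(\mu_A\otimes C_n)\circ(A\otimes s)\circ(s\otimes A)$, where $\mu$ denotes multiplication and an algebra symbol also denotes its identity map. The maps $\gamma^r_j\colon A\to A$ are defined by $s(y^r\otimes a)=\sum_{j=0}^{n-1}\gamma^r_j(a)\otimes y^j$ for $0\le r<n$, and $\gamma^r_j:=0$ for $r\ge n$, $0\le j<n$. The twisting map is upper triangular if $\gamma^1_0=0$. *)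

(* Defs.v *)
From HB Require Import structures.
From mathcomp Require Import all_boot all_algebra.
From mathcomp Require Import boolp.
From mathcomp.multinomials Require Import freeg.

Set Implicit Arguments.
Unset Strict Implicit.
Unset Printing Implicit Defensive.

Import GRing.Theory.
Local Open Scope ring_scope.
Local Open Scope quotient_scope.

Lemma fglift_is_linear (R : nzRingType) (M : lmodType R) (K : choiceType)
  (f : K -> M) : linear (fglift f : {freeg K / R} -> M).
Proof.
have addf := @lift_is_additive R K M f.
have f0 : fglift f 0 = 0 by rewrite -(subrr 0) addf subrr.
have fN D : fglift f (- D) = - fglift f D.
  by rewrite -[- D]sub0r addf f0 sub0r.
have fD D1 D2 : fglift f (D1 + D2) = fglift f D1 + fglift f D2.
  by rewrite -[D2 in LHS]opprK addf fN opprK.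
have fsum (r : seq K) (F : K -> {freeg K / R}) :
    fglift f (\sum_(x <- r) F x) = \sum_(x <- r) fglift f (F x).
  by elim/big_rec2: _ => // x u v _ <-; rewrite fD.
move=> c D1 D2; rewrite fD; congr (_ + _).
rewrite -[in RHS](freeg_sumE D1) !fsum scaler_sumr.
by apply: eq_bigr => x _; rewrite !liftU scalerA.
Qed.

HB.instance Definition _ (R : nzRingType) (M : lmodType R) (K : choiceType)
  (f : K -> M) :=
  GRing.isLinear.Build R {freeg K / R} M *:%R (fglift f) (fglift_is_linear f).

Section Tensor.
Context (k : comNzRingType) (U V : lmodType k).

(* The free k-module on the set U * V; << (u, v) >> is its basis vector. *)
Local Notation F := {freeg (U * V)%type / k}.

Definition bilinear_relators (S : F -> Prop) : Prop :=
  (forall (a : k) (u u' : U) (v : V),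
     S (<< (a *: u + u', v) >> - (a *: << (u, v) >> + << (u', v) >>))) /\
  (forall (a : k) (u : U) (v v' : V),
     S (<< (u, a *: v + v') >> - (a *: << (u, v) >> + << (u, v') >>))).

(* The submodule of F generated by the bilinearity relators. *)
Definition tensor_rel : {pred F} := fun D : F =>
  `[< forall S : {pred F}, submod_closed S ->
        bilinear_relators (fun E => E \in S) -> D \in S >].

Fact tensor_rel_submod_closed : submod_closed tensor_rel.
Proof.
split=> [|a D E /asboolP hD /asboolP hE]; apply/asboolP => S cS rS.
  by case: cS.
by case: (cS) => _; apply; [apply: hD | apply: hE].
Qed.

HB.instance Definition _ :=
  GRing.isSubmodClosed.Build k F tensor_rel tensor_rel_submod_closed.

Definition tensor : Type := Quotient.quot tensor_rel.
HB.instance Definition _ := GRing.Zmodule.on tensor.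

Definition tensor_pi (D : F) : tensor := \pi_(Quotient.quot tensor_rel) D.
Local Notation pi := tensor_pi.

Lemma tensor_piW (P : tensor -> Prop) : (forall D, P (pi D)) -> forall t, P t.
Proof. by move=> h t; rewrite -[t]reprK; apply: h. Qed.

Lemma tensor_piD (D E : F) : pi (D + E) = pi D + pi E.
Proof. by rewrite /tensor_pi piE. Qed.

Lemma tensor_piP (D E : F) : D - E \in tensor_rel <-> pi D = pi E.
Proof. by rewrite Quotient.idealrBE; split => /eqP. Qed.

Definition tensor_scale (a : k) (t : tensor) : tensor :=
  pi (a *: repr (t : Quotient.quot tensor_rel)).

Lemma tensor_scale_pi (a : k) (D : F) : tensor_scale a (pi D) = pi (a *: D).
Proof.
apply/tensor_piP; rewrite -scalerBr; apply: rpredZ; apply/tensor_piP.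
by rewrite /tensor_pi reprK.
Qed.

Fact tensor_scaleA a b t :
  tensor_scale a (tensor_scale b t) = tensor_scale (a * b) t.
Proof. by elim/tensor_piW: t => D; rewrite !tensor_scale_pi scalerA. Qed.

Fact tensor_scale1 : left_id 1 tensor_scale.
Proof. by move=> t; elim/tensor_piW: t => D; rewrite tensor_scale_pi scale1r. Qed.

Fact tensor_scaleDr : right_distributive tensor_scale +%R.
Proof.
move=> a t u; elim/tensor_piW: t => D; elim/tensor_piW: u => E.
by rewrite -tensor_piD !tensor_scale_pi scalerDr tensor_piD.
Qed.

Fact tensor_scaleDl t : {morph tensor_scale^~ t : a b / a + b}.
Proof.
move=> a b; elim/tensor_piW: t => D.
by rewrite !tensor_scale_pi scalerDl tensor_piD.
Qed.

HB.instance Definition _ := GRing.Zmodule_isLmodule.Build k tensor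
  tensor_scaleA tensor_scale1 tensor_scaleDr tensor_scaleDl.

Lemma tensor_piZ (a : k) (D : F) : pi (a *: D) = a *: pi D.
Proof. by rewrite -tensor_scale_pi. Qed.

Definition tens (u : U) (v : V) : tensor := pi << (u, v) >>.

Fact tens_is_bilinear : bilinear_for *:%R *:%R tens.
Proof.
split=> [v a u u' | u a v v']; rewrite /tens /= -tensor_piZ -tensor_piD.
  by apply/tensor_piP/asboolP => S _ [Sl _]; apply: Sl.
by apply/tensor_piP/asboolP => S _ [_ Sr]; apply: Sr.
Qed.

HB.instance Definition _ :=
  bilinear_isBilinear.Build k U V tensor *:%R *:%R tens tens_is_bilinear.

Section Lift.
Context (W : lmodType k) (f : {bilinear U -> V -> W}).

Let lift0 : F -> W := fglift (fun p : U * V => f p.1 p.2).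

Definition tlift (t : tensor) : W := lift0 (repr (t : Quotient.quot tensor_rel)).

Lemma tlift_pi (D : F) : tlift (pi D) = lift0 D.
Proof.
have lift0_rel E : E \in tensor_rel -> lift0 E = 0.
  move=> /asboolP /(_ (mem [pred E | lift0 E == 0])) h.
  apply/eqP/h => {h}.
    split=> [|a x y]; first by rewrite inE /lift0 linear0.
    rewrite !inE => /eqP hx /eqP hy.
    by rewrite [lift0 _]fglift_is_linear -!/(lift0 _) hx hy scaler0 addr0.
  split=> [a u u' v | a u v v']; rewrite inE /lift0 linearB linearD linearZ /= !liftU !scale1r /=.
    by rewrite linearPl subrr.
  by rewrite linearPr subrr.
apply/eqP; rewrite -subr_eq0 /tlift /lift0 -linearB; apply/eqP/lift0_rel.
by apply/tensor_piP; rewrite /tensor_pi reprK.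
Qed.

Lemma tlift_tens u v : tlift (tens u v) = f u v.
Proof. by rewrite tlift_pi /lift0 liftU scale1r. Qed.

Fact tlift_is_linear : linear tlift.
Proof.
move=> a t u; elim/tensor_piW: t => D; elim/tensor_piW: u => E.
by rewrite -tensor_piZ -tensor_piD !tlift_pi /lift0 linearP.
Qed.

HB.instance Definition _ :=
  GRing.isLinear.Build k tensor W *:%R tlift tlift_is_linear.
End Lift.

Lemma tensor_ind (P : tensor -> Prop) :
  (forall u v, P (tens u v)) -> (forall t t', P t -> P t' -> P (t + t')) ->
  forall t, P t.
Proof.
move=> Ptens PD; elim/tensor_piW => D; rewrite -(freeg_sumE D).
elim/big_rec: _ => [|[u v] E _ IH].
  rewrite -(scale0r (0 : F)) tensor_piZ scale0r -(linear0l tens 0).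
  exact: Ptens.
rewrite tensor_piD; apply: PD => //.
have -> : << coeff (u, v) D *g (u, v) >> = coeff (u, v) D *: << (u, v) >> :> F.
  by apply/eqP/freeg_eqP => q; rewrite coeffZ !coeffU mul1r.
rewrite tensor_piZ -[pi _]/(tens u v).
by have /= <- := linearZl_LR tens v (coeff (u, v) D) u.
Qed.

Lemma tensor_ext (W : lmodType k) (f g : {linear tensor -> W}) :
  (forall u v, f (tens u v) = g (tens u v)) -> f =1 g.
Proof.
move=> fg t; elim/tensor_ind: t => // t t' IH IH'.
by rewrite !linearD IH IH'.
Qed.
End Tensor.

Notation "u \ox v" := (tens u v) (at level 40, left associativity) : ring_scope.

Section TensorMaps.
Context (k : comNzRingType).

Section Map.
Context (U U' V V' : lmodType k) (f : {linear U -> U'}) (g : {linear V -> V'}).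

Definition tmap_fun (u : U) (v : V) : tensor U' V' := f u \ox g v.

Fact tmap_fun_is_bilinear : bilinear_for *:%R *:%R tmap_fun.
Proof.
by split=> [v|u] a w w'; rewrite /tmap_fun linearP ?linearPl ?linearPr.
Qed.

HB.instance Definition _ := bilinear_isBilinear.Build k U V (tensor U' V')
  *:%R *:%R tmap_fun tmap_fun_is_bilinear.

Definition tmap : {linear tensor U V -> tensor U' V'} := tlift tmap_fun.

Lemma tmapE u v : tmap (u \ox v) = f u \ox g v.
Proof. exact: tlift_tens. Qed.
End Map.

Section Assoc.
Context (U V W : lmodType k).

Definition assocl_fun (w : W) (u : U) (v : V) : tensor U (tensor V W) :=
  u \ox (v \ox w).

Fact assocl_fun_is_bilinear w : bilinear_for *:%R *:%R (assocl_fun w).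
Proof.
by split=> [v|u] a x x'; rewrite /assocl_fun !(linearPl, linearPr).
Qed.

HB.instance Definition _ w := bilinear_isBilinear.Build k U V
  (tensor U (tensor V W)) *:%R *:%R (assocl_fun w) (assocl_fun_is_bilinear w).

Definition assoc_fun (t : tensor U V) (w : W) : tensor U (tensor V W) :=
  tlift (assocl_fun w) t.

Fact assoc_fun_is_bilinear : bilinear_for *:%R *:%R assoc_fun.
Proof.
split=> [w|t] a x x'; rewrite /assoc_fun ?linearP //=.
elim/tensor_ind: t => [u v|t t' IH IH'].
  by rewrite !tlift_tens /= /assocl_fun !linearPr.
by rewrite !linearD /= IH IH' addrACA.
Qed.

HB.instance Definition _ := bilinear_isBilinear.Build k (tensor U V) W
  (tensor U (tensor V W)) *:%R *:%R assoc_fun assoc_fun_is_bilinear.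

Definition tassoc : {linear tensor (tensor U V) W -> tensor U (tensor V W)} :=
  tlift assoc_fun.

Lemma tassocE u v w : tassoc (u \ox v \ox w) = u \ox (v \ox w).
Proof. by rewrite [LHS]tlift_tens [LHS]tlift_tens. Qed.

Definition assocr_fun (u : U) (v : V) (w : W) : tensor (tensor U V) W :=
  u \ox v \ox w.

Fact assocr_fun_is_bilinear u : bilinear_for *:%R *:%R (assocr_fun u).
Proof.
by split=> [w|v] a x x'; rewrite /assocr_fun ?linearPr ?linearPl ?linearPr.
Qed.

HB.instance Definition _ u := bilinear_isBilinear.Build k V W
  (tensor (tensor U V) W) *:%R *:%R (assocr_fun u) (assocr_fun_is_bilinear u).

Definition assocV_fun (u : U) (t : tensor V W) : tensor (tensor U V) W :=
  tlift (assocr_fun u) t.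

Fact assocV_fun_is_bilinear : bilinear_for *:%R *:%R assocV_fun.
Proof.
split=> [t|u] a x x'; rewrite /assocV_fun ?linearP //=.
elim/tensor_ind: t => [v w|t t' IH IH'].
  by rewrite !tlift_tens /= /assocr_fun !linearPl.
by rewrite !linearD /= IH IH' addrACA.
Qed.

HB.instance Definition _ := bilinear_isBilinear.Build k U (tensor V W)
  (tensor (tensor U V) W) *:%R *:%R assocV_fun assocV_fun_is_bilinear.

Definition tassocV : {linear tensor U (tensor V W) -> tensor (tensor U V) W} :=
  tlift assocV_fun.

Lemma tassocVE u v w : tassocV (u \ox (v \ox w)) = u \ox v \ox w.
Proof. by rewrite [LHS]tlift_tens [LHS]tlift_tens. Qed.
End Assoc.

Section Mul.
Context (A : algType k).

Definition mul_fun (a b : A) : A := a * b.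

Fact mul_fun_is_bilinear : bilinear_for *:%R *:%R mul_fun.
Proof.
split=> [b|a] c x y; rewrite /mul_fun ?mulrDl ?mulrDr.
  by rewrite -scalerAl.
by rewrite -scalerAr.
Qed.

HB.instance Definition _ :=
  bilinear_isBilinear.Build k A A A *:%R *:%R mul_fun mul_fun_is_bilinear.

Definition tmul : {linear tensor A A -> A} := tlift mul_fun.

Lemma tmulE a b : tmul (a \ox b) = a * b.
Proof. exact: tlift_tens. Qed.
End Mul.

Section Twisting.
Context (C A : algType k) (s : {linear tensor C A -> tensor A C}).

Definition twisting_unit : Prop :=
  (forall a : A, s (1 \ox a) = a \ox 1) /\
  (forall c : C, s (c \ox 1) = 1 \ox c).

(* On (C (x) C) (x) A, resp. (C (x) A) (x) A, with explicit associators. *)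
Definition twisting_mull : Prop :=
  s \o tmap (tmul C) idfun =1
  tmap idfun (tmul C) \o tassoc A C C \o tmap s idfun \o tassocV C A C
    \o tmap idfun s \o tassoc C C A.

Definition twisting_mulr : Prop :=
  s \o tmap idfun (tmul A) \o tassoc C A A =1
  tmap (tmul A) idfun \o tassocV A A C \o tmap idfun s \o tassoc A C A
    \o tmap s idfun.

Definition is_twisting : Prop :=
  [/\ twisting_unit, twisting_mull & twisting_mulr].
End Twisting.

End TensorMaps.

(* [mk_monic 'X^n] is ['X^n] for 0 < n, but ['X] for n = 0. *)
Notation truncpoly k n := {poly %/ ('X^n : {poly k})}.

Section Gamma.
Context (k : comNzRingType) (n : nat) (A : algType k).
Local Notation C := (truncpoly k n).

Section Coef.
Variable j : nat.

Definition tcoef_fun (a : A) (c : C) : A := c`_j *: a.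

Fact tcoef_fun_is_bilinear : bilinear_for *:%R *:%R tcoef_fun.
Proof.
split=> [c|a] e x y; rewrite /tcoef_fun.
  by rewrite /= scalerDr !scalerA mulrC.
have -> : (e *: x + y : C)`_j = e * x`_j + y`_j by rewrite -coefZ -coefD.
by rewrite /= scalerDl scalerA.
Qed.

HB.instance Definition _ := bilinear_isBilinear.Build k A C A
  *:%R *:%R tcoef_fun tcoef_fun_is_bilinear.

(* The coordinate of y^j in A (x) C, as a free left A-module. *)
Definition tcoef : {linear tensor A C -> A} := tlift tcoef_fun.

Lemma tcoefE a (c : C) : tcoef (a \ox c) = c`_j *: a.
Proof. exact: tlift_tens. Qed.
End Coef.

(* For n <= r this is 0, because y^r = 0 in C; see gammaE and gamma_unique
   for the agreement with s (y^r (x) a) = sum_j gamma^r_j(a) (x) y^j. *)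
Definition gamma (s : {linear tensor C A -> tensor A C}) (r j : nat) (a : A) :
  A := tcoef j (s ('qX ^+ r \ox a)).

Hypothesis n_gt0 : (0 < n)%N.

Lemma truncpolyXn (r : nat) : (r < n)%N -> ('qX ^+ r : C) = 'X^r :> {poly k}.
Proof.
move=> ltrn; have -> : 'qX ^+ r = in_qpoly 'X^n 'X^r :> C by rewrite rmorphXn.
by rewrite in_qpoly_small // mk_monic_Xn !size_polyXn prednK.
Qed.

Lemma truncpolyXn_eq0 (r : nat) : (n <= r)%N -> 'qX ^+ r = 0 :> C.
Proof.
move=> lenr; have -> : 'qX ^+ r = in_qpoly 'X^n 'X^r :> C by rewrite rmorphXn.
apply: val_inj => /=; rewrite mk_monic_Xn prednK // -(subnK lenr) exprD.
exact/Pdiv.RingMonic.rmodp_mull/monicXn.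
Qed.

Lemma truncpolyE (c : C) : c = \sum_(j < n) c`_j *: 'qX ^+ j.
Proof.
apply: val_inj; rewrite [RHS]poly_of_qpoly_sum; apply/polyP => i.
rewrite coef_sum; have coefE (j : 'I_n) :
    (c`_j *: 'qX ^+ j : C)`_i = c`_j * (i == j)%:R.
  by rewrite poly_of_qpolyZ coefZ truncpolyXn // coefXn.
rewrite (eq_bigr _ (fun j _ => coefE j)); case: (ltnP i n) => [ltin|leni].
  rewrite (bigD1 (Ordinal ltin)) //= eqxx mulr1 big1 ?addr0 // => j neji.
  by rewrite eq_sym -[i]/(val (Ordinal ltin)) (inj_eq val_inj) (negPf neji) mulr0.
rewrite big1 => [|j _]; last by rewrite gtn_eqF ?mulr0 // (leq_trans _ leni).
apply: nth_default; apply: leq_trans leni.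
rewrite -ltnS (leq_trans (size_mk_monic c)) //.
by rewrite mk_monic_Xn size_polyXn prednK.
Qed.

Lemma tcoef_sum (t : tensor A C) : t = \sum_(j < n) tcoef j t \ox 'qX ^+ j.
Proof.
elim/tensor_ind: t => [a c|t t' IH IH'].
  rewrite [in LHS](truncpolyE c) linear_sumr.
  apply: eq_bigr => j _; rewrite tcoefE.
  by rewrite linearZr_LR linearZl_LR.
rewrite [in LHS]IH [in LHS]IH' -big_split; apply: eq_bigr => j _.
by rewrite linearD linearDl.
Qed.

Lemma gammaE (s : {linear tensor C A -> tensor A C}) (r : nat) (a : A) :
  s ('qX ^+ r \ox a) = \sum_(j < n) gamma s r j a \ox 'qX ^+ j.
Proof. exact: tcoef_sum. Qed.

Lemma gamma_unique (s : {linear tensor C A -> tensor A C}) (r : nat) (a : A)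
  (g : nat -> A) :
  s ('qX ^+ r \ox a) = \sum_(j < n) g j \ox 'qX ^+ j ->
  forall j, (j < n)%N -> g j = gamma s r j a.
Proof.
move=> sE j ltjn; rewrite /gamma sE linear_sum (bigD1 (Ordinal ltjn)) //=.
rewrite tcoefE truncpolyXn // coefXn eqxx scale1r big1 ?addr0 // => i neij.
rewrite tcoefE truncpolyXn // coefXn; case: eqP => [eji|_]; last by rewrite scale0r.
by case/eqP: neij; apply: val_inj.
Qed.

Lemma gamma_ge (s : {linear tensor C A -> tensor A C}) (r j : nat) (a : A) :
  (n <= r)%N -> gamma s r j a = 0.
Proof. by move=> lenr; rewrite /gamma truncpolyXn_eq0 // linear0l !linear0. Qed.
End Gamma.

Definition upper_triangular (k : comNzRingType) (n : nat) (A : algType k)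
    (s : {linear tensor (truncpoly k n) A -> tensor A (truncpoly k n)}) : Prop :=
  forall a, gamma s 1 0 a = 0.

(* Main.v *)
Require Import Defs.
From HB Require Import structures.
From mathcomp Require Import all_boot all_algebra.

Set Implicit Arguments.
Unset Strict Implicit.
Unset Printing Implicit Defensive.

Import GRing.Theory.
Local Open Scope ring_scope.

(** Write x and y for the generators of A = k[x]/(x^m) and C = k[y]/(y^n), and
    N for the nilpotent shift matrix in the ring of n by n matrices over A.

    A twisting map makes A (x) C an algebra in which c * a = s(c (x) a).  Its
    left A-module structure is free on 1, y, .., y^(n-1), and right
    multiplication by a has, on row vectors, the matrix
    phi(a) = (gamma^r_j(a))_{r,j}, while right multiplication by y has the
    matrix N.  The third axiom says that phi is a ring morphism, so phi is
    determined by the single matrix M = phi(x); for an upper triangular s the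
    second axiom gives
      N M = sum_{l >= 1} P_l(M) N^l,                                  ( * )
    and row 0 of M is (x, 0, .., 0) because s(1 (x) x) = x (x) 1.

    Uniqueness and existence of M.  Equation ( * ) gives row r+1 of M as row r
    of the right-hand side, whose column j involves only columns of M strictly
    to the left of j, since l >= 1 and everything is upper triangular.  Read as
    M = F(M) (twist_step), it thus has exactly one solution, reached from any
    starting matrix after n iterations of F (iter_twist_step_const).  Hence any
    two twisting maps as in the theorem have the same gamma matrices and are
    equal.

    From M to a twisting map.  Since x divides every P_l, it divides every
    entry of M, hence M^m = 0 (twistmx_nilpotent) and x |-> M extends to a
    morphism phi on A; likewise y |-> N gives psi on C.  The map
    a (x) c |-> phi(a) psi(c) is injective, because row 0 of its value lists
    the coordinates.  If every psi(c) phi(a) lies in its image, then pulling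
    these products back defines s, and the twisting axioms become associativity
    of matrix multiplication (factorization_is_twisting).

    Why psi(c) phi(a) lies in the image.  It is enough to treat N phi(a).
    Let defect X be the difference between X and the element of the image with
    the same row 0.  Rewriting N M^i with ( * ) creates further powers of N in
    front of powers of M, so a direct induction on i is circular; but N also
    raises the distance to the diagonal.  One shows by induction on d that
    defect (N phi(a)) vanishes below the d-th upper diagonal for every a
    (upper_defect_shift_phi); for d = n it is zero. *)

(** * Evaluation at matrices and truncated polynomials *)

Section MatrixEvaluation.
Variables (k : comNzRingType) (A : comAlgType k) (n : nat).
Implicit Types (X Y : 'M[A]_n.+1) (p q : {poly k}).

(** Matrices over A form an algebra over A rather than over k, so polynomials
    over k are first mapped to A. *)
Definition mxeval X : {poly k} -> 'M[A]_n.+1 :=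
  horner_mx X \o map_poly (in_alg A).

HB.instance Definition _ X :=
  GRing.RMorphism.copy (mxeval X) (horner_mx X \o map_poly (in_alg A)).

Lemma mxevalX X : mxeval X 'X = X.
Proof. by rewrite /mxeval /= map_polyX horner_mx_X. Qed.

Lemma mxevalC X c : mxeval X c%:P = c%:A%:M.
Proof. by rewrite /mxeval /= map_polyC horner_mx_C. Qed.

Lemma mxevalZ X c p : mxeval X (c *: p) = c%:A *: mxeval X p.
Proof. by rewrite -mul_polyC rmorphM /= mxevalC [_ * _]mul_scalar_mx. Qed.

Lemma mxeval_mulX X p c :
  mxeval X (p * 'X + c%:P) = mxeval X p * X + c%:A%:M.
Proof. by rewrite rmorphD rmorphM /= mxevalX mxevalC. Qed.
End MatrixEvaluation.

Section MatrixRepresentation.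
Variables (k : comNzRingType) (A : comAlgType k) (n : nat).
Variables (T : algType k) (f : {rmorphism T -> 'M[A]_n.+1}).
Hypothesis f_alg : forall c : k, f c%:A = c%:A%:M.

Lemma rmorph_mxZ c a : f (c *: a) = c%:A *: f a.
Proof. by rewrite -[c *: a]mulr_algl rmorphM f_alg [_ * _]mul_scalar_mx. Qed.

Lemma rmorph_mx_horner t q : f (horner_alg t q) = mxeval (f t) q.
Proof.
elim/poly_ind: q => [|q c IH]; first by rewrite !rmorph0.
by rewrite mxeval_mulX !rmorphD !rmorphM /= horner_algX horner_algC IH f_alg.
Qed.
End MatrixRepresentation.

Section TruncatedPolynomials.
Variables (k : comNzRingType) (d : nat).
Hypothesis d_gt0 : (0 < d)%N.
Local Notation T := (truncpoly k d).

Lemma horner_alg_qX q : horner_alg ('qX : T) q = in_qpoly 'X^d q.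
Proof.
elim/poly_ind: q => [|q c IH]; first by rewrite !rmorph0.
rewrite !rmorphD !rmorphM /= horner_algX horner_algC IH.
by congr (_ + _); rewrite -alg_polyC linearZ /= rmorph1.
Qed.

Lemma truncpolyK (a : T) : horner_alg ('qX : T) (a : {poly k}) = a.
Proof.
by rewrite horner_alg_qX; apply/val_inj/in_qpoly_small/size_mk_monic.
Qed.

Lemma truncpoly_gen (a : T) : exists q, a = horner_alg ('qX : T) q.
Proof. by exists a; rewrite truncpolyK. Qed.

Lemma coef_in_qpoly (q : {poly k}) j : (j < d)%N -> (in_qpoly 'X^d q)`_j = q`_j.
Proof.
move=> ltj; rewrite /= mk_monic_Xn prednK //.
rewrite [in RHS](Pdiv.RingMonic.rdivp_eq (monicXn k d) q) coefD coefMXn ltj.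
by rewrite add0r.
Qed.

Lemma coef_mul_qX (a : T) i j : (j < d)%N ->
  (a * 'qX ^+ i)`_j = if (i <= j)%N then a`_(j - i) else 0.
Proof.
move=> ltj; rewrite -[X in X * _]truncpolyK horner_alg_qX.
rewrite -[_ ^+ i]rmorphXn -rmorphM /= coef_in_qpoly // coefMXn ltnNge.
by case: leqP.
Qed.

Section UniversalProperty.
Variables (A : comAlgType k) (n : nat) (X : 'M[A]_n.+1).
Hypothesis Xd0 : X ^+ d = 0.

Definition trunceval (a : T) : 'M[A]_n.+1 := mxeval X (a : {poly k}).

(** The remainder modulo X^d and the polynomial itself have the same value at
    a matrix whose d-th power is zero. *)
Lemma trunceval_in_qpoly q : trunceval (in_qpoly 'X^d q) = mxeval X q.
Proof.
rewrite /trunceval /= mk_monic_Xn prednK //.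
rewrite [in RHS](Pdiv.RingMonic.rdivp_eq (monicXn k d) q) rmorphD rmorphM /=.
by rewrite rmorphXn /= mxevalX Xd0 mulr0 add0r.
Qed.

Fact trunceval_is_zmod_morphism : zmod_morphism trunceval.
Proof. by move=> a b; rewrite /trunceval -rmorphB. Qed.

Fact trunceval_is_monoid_morphism : monoid_morphism trunceval.
Proof.
split=> [|a b]; first exact: (rmorph1 (mxeval X)).
rewrite [trunceval (a * b)]trunceval_in_qpoly; exact: (rmorphM (mxeval X)).
Qed.

HB.instance Definition _ := GRing.isZmodMorphism.Build T 'M[A]_n.+1
  trunceval trunceval_is_zmod_morphism.
HB.instance Definition _ := GRing.isMonoidMorphism.Build T 'M[A]_n.+1
  trunceval trunceval_is_monoid_morphism.

Lemma truncpoly_rmorphism_exists : exists f : {rmorphism T -> 'M[A]_n.+1},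
  (forall c : k, f c%:A = c%:A%:M) /\ f 'qX = X.
Proof.
exists trunceval; split=> [c|] /=; last by rewrite trunceval_in_qpoly mxevalX.
by rewrite /trunceval -scalemx1 -[1%:M]/1 -(rmorph1 (mxeval X)) -mxevalZ.
Qed.
End UniversalProperty.
End TruncatedPolynomials.

(** * The shift matrix and the filtration by upper diagonals *)

Section Shift.
Variables (A : comNzRingType) (n : nat).
Implicit Types X Y : 'M[A]_n.+1.

Definition shift : 'M[A]_n.+1 := \matrix_(i, j) (j == i.+1 :> nat)%:R.

Lemma mul_shiftE X i j :
  (X * shift) i j = if (0 < j)%N then X i (inord j.-1) else 0.
Proof.
rewrite mxE; case: ifP => [j_gt0|/negbT]; last first.
  rewrite -eqn0Ngt => /eqP j0; rewrite big1 // => l _.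
  by rewrite mxE j0 mulr0.
have ltj : (j.-1 < n.+1)%N by rewrite (leq_ltn_trans (leq_pred _)).
rewrite (bigD1 (inord j.-1)) //= big1 ?addr0 => [|l nel].
  by rewrite mxE inordK // prednK // eqxx mulr1.
rewrite mxE; case: eqP => [ej|]; last by rewrite mulr0.
by case/eqP: nel; apply: val_inj; rewrite /= inordK // ej.
Qed.

Lemma shift_mulE X i j :
  (shift * X) i j = if (i.+1 < n.+1)%N then X (inord i.+1) j else 0.
Proof.
rewrite mxE; case: ifP => [lti|/negbT]; last first.
  rewrite -leqNgt => lei; rewrite big1 // => l _.
  by rewrite mxE ltn_eqF ?mul0r // (leq_trans (ltn_ord l)).
rewrite (bigD1 (inord i.+1)) //= big1 ?addr0 => [|l nel].
  by rewrite mxE inordK // eqxx mul1r.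
rewrite mxE; case: eqP => [ej|]; last by rewrite mul0r.
by case/eqP: nel; apply: val_inj; rewrite /= inordK // ej.
Qed.

Lemma trshift_mulE X i j :
  (shift^T * X) i j = if (0 < i)%N then X (inord i.-1) j else 0.
Proof.
have -> : shift^T * X = (X^T * shift)^T by rewrite trmx_mul trmxK.
by rewrite mxE mul_shiftE mxE.
Qed.

Lemma mul_shiftXE X l i j :
  (X * shift ^+ l) i j = if (l <= j)%N then X i (inord (j - l)) else 0.
Proof.
elim: l X j => [|l IH] X j; first by rewrite expr0 mulr1 subn0 inord_val.
rewrite exprS mulrA IH; case: (leqP l j) => [lej|ltj]; last first.
  by rewrite ltnNge ltnW //.
rewrite mul_shiftE inordK; last by rewrite (leq_ltn_trans (leq_subr _ _)).
by rewrite subn_gt0 subnS.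
Qed.

(** These sets form a multiplicative filtration (upperM); upper 0 is the ring
    of upper triangular matrices, and shift lies in upper 1. *)
Definition upper d X := forall i j : 'I_n.+1, (j < i + d)%N -> X i j = 0.

Lemma upperW d e X : (e <= d)%N -> upper d X -> upper e X.
Proof.
by move=> led uX i j ltj; apply: uX; rewrite (leq_trans ltj) ?leq_add2l.
Qed.

Lemma upper0 d : upper d 0.
Proof. by move=> i j _; rewrite mxE. Qed.

Lemma upperD d X Y : upper d X -> upper d Y -> upper d (X + Y).
Proof. by move=> uX uY i j lt; rewrite mxE uX ?uY ?addr0. Qed.

Lemma upperB d X Y : upper d X -> upper d Y -> upper d (X - Y).
Proof. by move=> uX uY i j lt; rewrite !mxE uX ?uY ?subr0. Qed.

Lemma upper_sum (I : Type) (r : seq I) (P : pred I) (F : I -> 'M[A]_n.+1) d :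
  (forall i, P i -> upper d (F i)) -> upper d (\sum_(i <- r | P i) F i).
Proof.
move=> uF; elim/big_rec: _ => [|i X Pi uX]; first exact: upper0.
by apply: upperD => //; apply: uF.
Qed.

Lemma upper_scalar (a : A) : upper 0 a%:M.
Proof. by move=> i j; rewrite addn0 mxE => ltj; rewrite -val_eqE gtn_eqF. Qed.

Lemma upperM d e X Y : upper d X -> upper e Y -> upper (d + e) (X * Y).
Proof.
move=> uX uY i j ltj; rewrite mxE big1 // => l _.
case: (ltnP l (i + d)) => [|lel]; first by move/uX->; rewrite mul0r.
by rewrite uY ?mulr0 // (leq_trans ltj) // addnA leq_add2r.
Qed.

Lemma upper_shift : upper 1 shift.
Proof. by move=> i j; rewrite addn1 mxE => ltj; rewrite ltn_eqF. Qed.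

Lemma upper_shiftX l : upper l (shift ^+ l).
Proof.
elim: l => [|l IH]; first exact: (upper_scalar 1).
by rewrite exprS -add1n; apply: upperM IH; apply: upper_shift.
Qed.

Lemma upper_eq0 X : upper n.+1 X -> X = 0.
Proof. by move=> uX; apply/matrixP=> i j; rewrite mxE uX // ltn_addl. Qed.

Lemma shiftX_eq0 : shift ^+ n.+1 = 0.
Proof. exact/upper_eq0/upper_shiftX. Qed.

Lemma shift_trshiftK X : upper 1 X -> shift * (shift^T * X) = X.
Proof.
move=> uX; apply/matrixP => i j; rewrite shift_mulE; case: ifP => [lti|].
  by rewrite trshift_mulE inordK //= inord_val.
by move/negbT; rewrite -leqNgt => lei; rewrite uX // addn1 (leq_trans _ lei).
Qed.
End Shift.

Arguments shift {A n}.

Lemma upper_mxeval (k : comNzRingType) (A : comAlgType k) (n : nat)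
  (X : 'M[A]_n.+1) p : upper 0 X -> upper 0 (mxeval X p).
Proof.
move=> uX; elim/poly_ind: p => [|p c IH].
  by rewrite rmorph0; apply: upper0.
rewrite mxeval_mulX; apply: upperD; last exact: upper_scalar.
exact: (upperM IH uX).
Qed.

(** * The matrix of right multiplication by x *)

Section Solution.
Variables (k : comNzRingType) (A : comAlgType k) (n : nat).
Variables (x : A) (p : nat -> {poly k}).
Implicit Types X Y M : 'M[A]_n.+1.

(** The right-hand side of the commutation relation
    N X = sum_(l >= 1) P_l(X) N^l. *)
Definition relmx X : 'M[A]_n.+1 :=
  \sum_(1 <= l < n.+1) mxeval X (p l) * shift ^+ l.

(** Multiplication by the transposed shift moves all rows down by one: row 0
    of the result is (x, 0, .., 0), and row r.+1 is row r of relmx X. *)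
Definition twist_step X : 'M[A]_n.+1 := x *: delta_mx 0 0 + shift^T * relmx X.

(** Triangularity of the first c columns is part of the relation: without it
    column j of a product could depend on columns to the right of j. *)
Definition agree c X Y := forall i j : 'I_n.+1, (j < c)%N ->
  X i j = Y i j /\ ((j < i)%N -> X i j = 0).

Lemma agreeM c X X' Y Y' :
  agree c X X' -> agree c Y Y' -> agree c (X * Y) (X' * Y').
Proof.
move=> aX aY i j ltj; split=> [|ltji].
  rewrite !mxE; apply: eq_bigr => l _; case: (leqP l j) => [lelj|ltjl].
    by rewrite (aX i l (leq_ltn_trans lelj ltj)).1 (aY l j ltj).1.
  by have [<- ->] := aY l j ltj; rewrite // !mulr0.
rewrite !mxE big1 // => l _; case: (leqP l j) => [lelj|ltjl].
  by rewrite (aX i l (leq_ltn_trans lelj ltj)).2 ?mul0r // (leq_ltn_trans lelj).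
by rewrite (aY l j ltj).2 ?mulr0.
Qed.

Lemma agree_mxeval c X Y q :
  agree c X Y -> agree c (mxeval X q) (mxeval Y q).
Proof.
move=> aXY; elim/poly_ind: q => [|q a IH] i j ltj.
  by rewrite !rmorph0 mxE.
rewrite !mxeval_mulX [LHS]mxE [in RHS]mxE; have [<- z] := agreeM IH aXY i ltj.
split=> // ltji; rewrite mxE z // add0r.
by rewrite (@upper_scalar _ _ a%:A i j) // addn0.
Qed.

Lemma twist_stepE X i j : twist_step X i j =
  if (0 < i)%N then relmx X (inord i.-1) j else x *+ (j == 0).
Proof.
rewrite mxE trshift_mulE !mxE lt0n -val_eqE /=; case: eqP => [_|_] /=.
  by rewrite addr0 mulr_natr.
by rewrite mulr0 add0r.
Qed.

(** This is where the fixed point iteration gains one column. *)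
Lemma agree_relmx c X Y (i j : 'I_n.+1) : agree c X Y -> (j < c.+1)%N ->
  relmx X i j = relmx Y i j /\ ((j < i.+1)%N -> relmx X i j = 0).
Proof.
move=> aXY ltj; rewrite /relmx !summxE !big_nat.
(* As l > 0, column j of a product with shift ^+ l is one of the columns
   strictly to its left, where X and Y already agree. *)
have ltjl l : (0 < l)%N -> (l <= j)%N -> (j - l < c)%N.
  by move=> l_gt0 lej; rewrite ltn_subLR // (leq_trans ltj) // -add1n leq_add2r.
have ltjln l : (j - l < n.+1)%N by rewrite (leq_ltn_trans (leq_subr _ _)).
split=> [|leji].
  apply: eq_bigr => l /andP[l_gt0 _]; rewrite !mul_shiftXE; case: ifP => // lej.
  by apply: (agree_mxeval (p l) aXY _ _).1; rewrite inordK // ltjl.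
rewrite big1 // => l /andP[l_gt0 _]; rewrite mul_shiftXE; case: ifP => // lej.
apply: (agree_mxeval (p l) aXY _ _).2; rewrite !inordK ?ltjl //.
by rewrite ltn_subLR // (leq_trans leji) // -add1n leq_add2r.
Qed.

Lemma agree_step c X Y :
  agree c X Y -> agree c.+1 (twist_step X) (twist_step Y).
Proof.
move=> aXY i j ltj; rewrite !twist_stepE; case: posnP => [i0|i_gt0].
  by rewrite i0; split.
have [e z] := agree_relmx (inord i.-1) aXY ltj.
split=> // ltji; apply: z; rewrite inordK ?prednK //.
by rewrite ltnW.
Qed.

Lemma iter_twist_step c X Y :
  agree c (iter c twist_step X) (iter c twist_step Y).
Proof. by elim: c => [|c IH] //; apply: agree_step. Qed.

Lemma iter_twist_step_const X Y :
  iter n.+1 twist_step X = iter n.+1 twist_step Y.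
Proof.
by apply/matrixP => i j; have [] := @iter_twist_step n.+1 X Y i j (ltn_ord j).
Qed.

Lemma twist_step_fixed_unique X Y :
  twist_step X = X -> twist_step Y = Y -> X = Y.
Proof.
move=> fX fY; have fix_iter Z c : twist_step Z = Z -> iter c twist_step Z = Z.
  by move=> fZ; elim: c => //= c ->.
rewrite -(fix_iter X n.+1 fX) -(fix_iter Y n.+1 fY).
exact: iter_twist_step_const.
Qed.

(** Every starting point gives the same matrix, as n.+1 iterations determine all
    n.+1 columns; from 0, divisibility by x is inherited at each step. *)
Definition twistmx : 'M[A]_n.+1 := iter n.+1 twist_step 0.

(** Iterating once more amounts to starting from twist_step 0 instead of 0,
    which does not change the result. *)
Lemma twistmx_fixed : twist_step twistmx = twistmx.
Proof. by rewrite /twistmx -iterS iterSr; apply: iter_twist_step_const. Qed.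

Lemma upper_twistmx : upper 0 twistmx.
Proof.
move=> i j; rewrite addn0.
by have [] := @iter_twist_step n.+1 0 0 i j (ltn_ord j).
Qed.

Lemma twistmx_row0 j : twistmx 0 j = x *+ (j == 0).
Proof. by rewrite -twistmx_fixed twist_stepE. Qed.

(** The hypothesis says that the first basis row vector is a left eigenvector of
    M for the eigenvalue x; hence it is one of q(M) for q(x). *)
Lemma mxeval_row0 M (q : {poly k}) : (forall j, M 0 j = x *+ (j == 0)) ->
  forall j, mxeval M q 0 j = horner_alg x q *+ (j == 0).
Proof.
move=> M0; elim/poly_ind: q => [|q c IH] j.
  by rewrite !rmorph0 mxE mul0rn.
rewrite mxeval_mulX mxE rmorphD rmorphM /= horner_algX horner_algC mulrnDl.
congr (_ + _); last by rewrite mxE eq_sym.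
rewrite mxE (bigD1 0) //= big1 ?addr0 => [|l nel].
  by rewrite IH eqxx M0 mulrnAr.
by rewrite IH (negPf nel) mul0r.
Qed.

Lemma upper_relmx X : upper 0 X -> upper 1 (relmx X).
Proof.
move=> uX; rewrite /relmx big_nat; apply: upper_sum => l /andP[l_gt0 _].
apply: (upperW l_gt0).
exact (upperM (upper_mxeval (p l) uX) (@upper_shiftX A n l)).
Qed.

(** The shift undoes the move of the rows in twist_step; the last row, which
    is lost there, is zero because relmx is strictly upper triangular. *)
Lemma shift_twistmx : shift * twistmx = relmx twistmx.
Proof.
rewrite -[in LHS]twistmx_fixed mulrDr shift_trshiftK; last first.
  exact/upper_relmx/upper_twistmx.
rewrite [X in X + _](_ : _ = 0) ?add0r //; apply/matrixP=> i j.
rewrite shift_mulE !mxE; case: ifP => // lti.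
by rewrite -val_eqE /= inordK // mulr0.
Qed.

Lemma twist_step_fixed M : (forall j, M 0 j = x *+ (j == 0)) ->
  shift * M = relmx M -> twist_step M = M.
Proof.
move=> M0 relM; apply/matrixP=> i j; rewrite twist_stepE.
case: posnP => [i0|i_gt0]; first by rewrite -M0; congr (M _ j); apply: val_inj.
have lti : (i.-1 < n.+1)%N by rewrite (leq_ltn_trans (leq_pred _)).
by rewrite -relM shift_mulE inordK // prednK // ltn_ord inord_val.
Qed.

Hypothesis p0 : forall l, (0 < l < n.+1)%N -> (p l)`_0 = 0.

(** Divisibility by x survives each step: writing P_l = Q_l X, the matrix
    P_l(M) = Q_l(M) M is a multiple of x as soon as M is. *)
Lemma twistmx_divisible : exists Y, twistmx = x *: Y.
Proof.
suffices divisible c : exists Y, iter c twist_step 0 = x *: Y.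
  exact: divisible.
elim: c => [|c [Y eY]]; first by exists 0; rewrite scaler0.
rewrite iterS; set X := iter _ _ _ in eY *.
exists (delta_mx 0 0 + shift^T *
  \sum_(1 <= l < n.+1) mxeval X (drop_poly 1 (p l)) * Y * shift ^+ l).
rewrite /twist_step scalerDr scalerAr scaler_sumr /relmx !big_nat.
congr (_ + _ * _); apply: eq_bigr => l /p0 pl0.
have pE : p l = drop_poly 1 (p l) * 'X.
  rewrite -[LHS](poly_take_drop 1) expr1 [take_poly 1 _](_ : _ = 0) ?add0r //.
  by apply/polyP=> [[|i]]; rewrite coef_take_poly coef0.
by rewrite [in LHS]pE rmorphM /= mxevalX [Z in _ * Z * _]eY -scalerAr -scalerAl.
Qed.

Lemma twistmx_nilpotent m : x ^+ m = 0 -> twistmx ^+ m = 0.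
Proof.
by have [Y ->] := twistmx_divisible; rewrite exprZn => ->; rewrite scale0r.
Qed.
End Solution.

(** * Matrices determined by their row 0 *)

Section RowExpansion.
Variables (A : comNzRingType) (n : nat) (phi : {rmorphism A -> 'M[A]_n.+1}).
Hypothesis phi_row0 : forall a j, phi a 0 j = a *+ (j == 0).
Hypothesis upper_phi : forall a, upper 0 (phi a).
Implicit Types (a b : A) (X Y : 'M[A]_n.+1).

Lemma phi_mul_row0 a X j : (phi a * X) 0 j = a * X 0 j.
Proof.
rewrite mxE (bigD1 0) //= phi_row0 eqxx big1 ?addr0 // => l nel.
by rewrite phi_row0 (negPf nel) mul0r.
Qed.

Lemma phi_shiftX_row0 a l (j : 'I_n.+1) :
  (phi a * shift ^+ l) 0 j = a *+ (l == j).
Proof.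
rewrite phi_mul_row0 -[_ ^+ l]mul1r mul_shiftXE -mulr_natr; congr (_ * _).
case: ltngtP => [ltlj|ltjl|->]; last by rewrite subnn mxE -val_eqE /= inordK.
  rewrite mxE -val_eqE /= inordK; first by rewrite eq_sym subn_eq0 leqNgt ltlj.
  by rewrite (leq_ltn_trans (leq_subr _ _)).
by [].
Qed.

(** The unique sum of matrices phi(a_j) N^j that has the same row 0 as X. *)
Definition row0_expand X : 'M[A]_n.+1 :=
  \sum_(j < n.+1) phi (X 0 j) * shift ^+ j.

(** It vanishes exactly when X lies in the left phi(A)-span of the powers of
    the shift, that is, in the image of A (x) C. *)
Definition defect X := X - row0_expand X.

Fact defect_is_zmod_morphism : zmod_morphism defect.
Proof.
have expandB X Y : row0_expand (X - Y) = row0_expand X - row0_expand Y.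
  by rewrite -sumrB; apply: eq_bigr => j _; rewrite !mxE rmorphB mulrBl.
by move=> X Y; rewrite /defect expandB !opprD opprK addrACA.
Qed.

HB.instance Definition _ := GRing.isZmodMorphism.Build 'M[A]_n.+1 'M[A]_n.+1
  defect defect_is_zmod_morphism.

Lemma defect_phi_mul a X : defect (phi a * X) = phi a * defect X.
Proof.
rewrite /defect mulrBr mulr_sumr; congr (_ - _); apply: eq_bigr => j _.
by rewrite phi_mul_row0 rmorphM mulrA.
Qed.

Lemma defect_mul_shift X : defect (X * shift) = defect X * shift.
Proof.
rewrite /defect mulrBl; congr (_ - _); rewrite /row0_expand mulr_suml.
rewrite big_ord_recl big_ord_recr /= -mulrA -exprSr shiftX_eq0 mulr0 addr0.
rewrite mul_shiftE /= rmorph0 mul0r add0r; apply: eq_bigr => j _.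
rewrite -mulrA -exprSr; congr (phi _ * _); rewrite mul_shiftE /=; congr (X 0 _).
by apply: val_inj; rewrite /= inordK //; apply: leqW (ltn_ord j).
Qed.

Lemma defect_mul_shiftX X l : defect (X * shift ^+ l) = defect X * shift ^+ l.
Proof.
elim: l => [|l IH]; first by rewrite expr0 !mulr1.
by rewrite exprSr !mulrA defect_mul_shift IH.
Qed.

Lemma defect1 : defect 1 = 0.
Proof.
rewrite /defect /row0_expand big_ord_recl /= mxE eqxx rmorph1 mulr1.
rewrite big1 ?addr0 ?subrr // => j _.
by rewrite mxE rmorph0 mul0r.
Qed.

Lemma defect_phi a : defect (phi a) = 0.
Proof. by rewrite -[phi a]mulr1 defect_phi_mul defect1 mulr0. Qed.

Lemma upper_defect d X : upper d X -> upper d (defect X).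
Proof.
move=> uX; apply: upperB => //; apply: upper_sum => j _.
case: (ltnP j d) => [ltjd|ledj].
  by rewrite uX // rmorph0 mul0r; apply: upper0.
apply: (upperW ledj).
exact (upperM (upper_phi (X 0 j)) (@upper_shiftX A n j)).
Qed.

(** Split X into row0_expand X and its defect, and multiply both by N. *)
Lemma defect_shift_mul X : defect (shift * X) =
  \sum_(j < n.+1) defect (shift * phi (X 0 j)) * shift ^+ j +
  defect (shift * defect X).
Proof.
rewrite -[X in LHS](subrK (row0_expand X)) -/(defect X) mulrDr raddfD /= addrC.
congr (_ + _); rewrite mulr_sumr raddf_sum; apply: eq_bigr => j _.
by rewrite /= mulrA defect_mul_shiftX.
Qed.

Lemma defect_shift_mul_eq0 X :
  (forall a, defect (shift * phi a) = 0) -> defect X = 0 ->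
  defect (shift * X) = 0.
Proof.
move=> shiftD X0; rewrite defect_shift_mul X0 mulr0 raddf0 addr0.
by rewrite big1 // => j _; rewrite shiftD mul0r.
Qed.

(** Here the induction on d gains one diagonal.  If X 0 0 = 0, the expansion of
    X only has terms phi(a_j) N^j with j > 0, and for these the trailing N^j
    improves the bound on defect (N phi(a_j)); the defect of X itself is
    improved by the leading N. *)
Lemma upper_defect_shift_mul d X :
  (forall a, upper d (defect (shift * phi a))) ->
  X 0 0 = 0 -> upper d (defect X) -> upper d.+1 (defect (shift * X)).
Proof.
move=> shiftD X00 dX; rewrite defect_shift_mul; apply: upperD; last first.
  by apply: upper_defect; exact (upperM (@upper_shift A n) dX).
apply: upper_sum => j _; have [j0|j_gt0] := posnP j.
  rewrite (_ : j = 0) ?X00 ?rmorph0; last exact: val_inj.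
  by rewrite mulr0 raddf0 mul0r; apply: upper0.
apply: (@upperW _ _ (d + j)); first by rewrite -addn1 leq_add2l.
exact (upperM (shiftD (X 0 j)) (@upper_shiftX A n j)).
Qed.
End RowExpansion.

(** * Moving the shift past phi *)

Section Exchange.
Variables (k : comNzRingType) (A : comAlgType k) (n : nat).
Variables (phi : {rmorphism A -> 'M[A]_n.+1}) (x : A) (P : nat -> A).
Hypothesis phi_row0 : forall a j, phi a 0 j = a *+ (j == 0).
Hypothesis upper_phi : forall a, upper 0 (phi a).
Hypothesis phi_alg : forall c : k, phi c%:A = c%:A%:M.
Hypothesis gen_x : forall a, exists q, a = horner_alg x q.
Hypothesis shift_phi_x :
  shift * phi x = \sum_(1 <= l < n.+1) phi (P l) * shift ^+ l.
Implicit Types (a b : A) (X Y : 'M[A]_n.+1).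

Local Notation defect := (defect phi).

(** Induction on d, and for fixed d on a polynomial expression of a in x.  For
    a = b x the relation turns N phi(a) into the sum of the
    phi(P_l) N^l phi(b) with l > 0.  For l = 1 the induction on the polynomial
    applies; for l > 1, N^l phi(b) = N (N^(l-1) phi(b)) has a second factor
    whose entry (0, 0) is zero, so that upper_defect_shift_mul applies. *)
Lemma upper_defect_shift_phi d a : upper d (defect (shift * phi a)).
Proof.
elim: d a => [|d IHd] a.
  apply: upper_defect => //; apply: (@upperW _ _ 1) => //.
  exact (upperM (@upper_shift A n) (upper_phi a)).
have [q ->] := gen_x a; elim/poly_ind: q => [|q c IHq].
  by rewrite !rmorph0 mulr0 raddf0; apply: upper0.
rewrite !rmorphD !rmorphM /= horner_algX horner_algC.
move: (horner_alg x q) IHq => b IHb.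
have shiftX_case l : (0 < l)%N -> upper d.+1 (defect (shift ^+ l * phi b)).
  case: l => // l _; elim: l => [|l IHl]; first by rewrite expr1.
  rewrite exprS -mulrA; apply: upper_defect_shift_mul => //.
    by apply: (upperM (@upper_shiftX A n l.+1) (upper_phi b)); rewrite addn0.
  exact: (upperW (leqnSn _) IHl).
(* Commutativity of A puts x next to the shift. *)
rewrite -rmorphM mulrC rmorphM mulrDr mulrA raddfD /=; apply: upperD; last first.
  rewrite phi_alg [shift * _](_ : _ = phi c%:A * (1 * shift)); last first.
    by rewrite mul1r phi_alg; apply/esym/comm_scalar_mx.
  rewrite defect_phi_mul // defect_mul_shift // defect1 // mul0r mulr0.
  exact: upper0.
rewrite shift_phi_x mulr_suml raddf_sum big_nat.
apply: upper_sum => l /andP[l_gt0 _]; rewrite /= -mulrA defect_phi_mul //.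
exact (upperM (upper_phi (P l)) (shiftX_case l l_gt0)).
Qed.

Lemma defect_shift_phi a : defect (shift * phi a) = 0.
Proof. exact: upper_eq0 (@upper_defect_shift_phi n.+1 a). Qed.
End Exchange.

(** * Twisting maps from factorizations *)

Section TwistingFromFactorization.
Variables (k : comNzRingType) (C A : algType k) (E : nzRingType).
Variables (phi : {rmorphism A -> E}) (psi : {rmorphism C -> E}).
Variables (theta : {additive tensor A C -> E}).
Variable s : {linear tensor C A -> tensor A C}.
Hypothesis thetaE : forall a c, theta (a \ox c) = phi a * psi c.
Hypothesis theta_inj : injective theta.
Hypothesis theta_s : forall c a, theta (s (c \ox a)) = psi c * phi a.

(** Through theta, the two outer maps in the twisting axioms are right
    multiplication by psi(c) and left multiplication by phi(a). *)
Lemma theta_mulr t c :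
  theta (tmap idfun (tmul C) (tassoc A C C (t \ox c))) = theta t * psi c.
Proof.
elim/tensor_ind: t => [a d|t t' IH IH'].
  by rewrite tassocE tmapE tmulE !thetaE rmorphM mulrA.
by rewrite linearDl !linearD raddfD /= IH IH' raddfD mulrDl.
Qed.

Lemma theta_mull a t :
  theta (tmap (tmul A) idfun (tassocV A A C (a \ox t))) = phi a * theta t.
Proof.
elim/tensor_ind: t => [b d|t t' IH IH'].
  by rewrite tassocVE tmapE tmulE !thetaE rmorphM mulrA.
by rewrite linearDr !linearD raddfD /= IH IH' raddfD mulrDr.
Qed.

Lemma factorization_twisting_mull : twisting_mull s.
Proof.
move=> t; apply: theta_inj; elim/tensor_ind: t => [u a|t t' IH IH']; last first.
  by rewrite !linearD !raddfD IH IH'.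
elim/tensor_ind: u => [c d|u u' IH IH']; last first.
  by rewrite linearDl !linearD !raddfD IH IH'.
rewrite /= tmapE tmulE theta_s tassocE tmapE rmorphM -mulrA -theta_s.
move: (s (d \ox a)) => t.
elim/tensor_ind: t => [b e|t t' IH IH'].
  by rewrite tassocVE tmapE theta_mulr theta_s thetaE mulrA.
by rewrite raddfD mulrDr IH IH' linearDr !linearD raddfD.
Qed.

Lemma factorization_twisting_mulr : twisting_mulr s.
Proof.
move=> t; apply: theta_inj; elim/tensor_ind: t => [u b|t t' IH IH']; last first.
  by rewrite !linearD !raddfD IH IH'.
elim/tensor_ind: u => [c a|u u' IH IH']; last first.
  by rewrite linearDl !linearD !raddfD IH IH'.
rewrite /= tassocE tmapE tmulE theta_s tmapE rmorphM mulrA -theta_s.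
move: (s (c \ox a)) => t.
elim/tensor_ind: t => [a' e|t t' IH IH'].
  by rewrite tassocE tmapE theta_mull theta_s thetaE mulrA.
by rewrite raddfD mulrDl IH IH' linearDl !linearD raddfD.
Qed.

(** theta identifies A (x) C with a subset of the ring E containing every
    psi(c) phi(a), so both sides of each axiom become the same product in E,
    bracketed in two ways. *)
Lemma factorization_is_twisting : is_twisting s.
Proof.
split; [|exact: factorization_twisting_mull|exact: factorization_twisting_mulr].
split=> [a|c]; apply: theta_inj; rewrite theta_s thetaE !rmorph1.
  by rewrite mulr1 mul1r.
by rewrite mulr1 mul1r.
Qed.
End TwistingFromFactorization.

(** * The twisting map attached to a matrix representation *)

Section TwistingFromMatrices.
Variables (k : comNzRingType) (A : comAlgType k) (n : nat).
Variable phi : {rmorphism A -> 'M[A]_n.+1}.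
Hypothesis phi_row0 : forall a j, phi a 0 j = a *+ (j == 0).
Hypothesis phi_alg : forall c : k, phi c%:A = c%:A%:M.
Hypothesis defect_shift_phi : forall a, defect phi (shift * phi a) = 0.
Local Notation C := (truncpoly k n.+1).

Variable psi : {rmorphism C -> 'M[A]_n.+1}.
Hypothesis psi_alg : forall c : k, psi c%:A = c%:A%:M.
Hypothesis psi_qX : psi 'qX = shift.

Definition twist_fun (c : C) (a : A) : tensor A C :=
  \sum_(j < n.+1) (psi c * phi a) 0 j \ox 'qX ^+ j.

Fact twist_fun_is_bilinear : bilinear_for *:%R *:%R twist_fun.
Proof.
split=> [a|c] e y z; rewrite /= /twist_fun scaler_sumr -big_split;
  apply: eq_bigr => j _.
  rewrite rmorphD (rmorph_mxZ psi_alg e y) mulrDl -scalerAl mxE linearDl.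
  by rewrite mxE mulr_algl linearZl_LR.
rewrite rmorphD (rmorph_mxZ phi_alg e y) mulrDr -scalerAr mxE linearDl.
by rewrite mxE mulr_algl linearZl_LR.
Qed.

HB.instance Definition _ := bilinear_isBilinear.Build k C A (tensor A C)
  *:%R *:%R twist_fun twist_fun_is_bilinear.

Definition matrix_twist : {linear tensor C A -> tensor A C} := tlift twist_fun.

Definition tensor_mx (t : tensor A C) : 'M[A]_n.+1 :=
  \sum_(j < n.+1) phi (tcoef n.+1 A j t) * shift ^+ j.

Fact tensor_mx_is_zmod_morphism : zmod_morphism tensor_mx.
Proof.
move=> t u; rewrite /tensor_mx -sumrB; apply: eq_bigr => j _.
by rewrite !raddfB mulrBl.
Qed.

HB.instance Definition _ := GRing.isZmodMorphism.Build (tensor A C) 'M[A]_n.+1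
  tensor_mx tensor_mx_is_zmod_morphism.

Lemma tensor_mx_tens a c : tensor_mx (a \ox c) = phi a * psi c.
Proof.
rewrite [c in RHS](truncpolyE (ltn0Sn n)) rmorph_sum mulr_sumr.
apply: eq_bigr => j _; rewrite tcoefE (rmorph_mxZ phi_alg) -scalerAl.
by rewrite (rmorph_mxZ psi_alg c`_j ('qX ^+ j)) -scalerAr rmorphXn psi_qX.
Qed.

(** Row 0 recovers the coordinates of t; this makes tensor_mx injective. *)
Lemma tensor_mx_row0 t j : tensor_mx t 0 j = tcoef n.+1 A j t.
Proof.
rewrite summxE (bigD1 j) //= phi_shiftX_row0 // eqxx big1 ?addr0 // => l nel.
by rewrite phi_shiftX_row0 // val_eqE (negPf nel).
Qed.

Lemma tensor_mx_inj : injective tensor_mx.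
Proof.
move=> t u etu; rewrite (tcoef_sum (ltn0Sn n) t) (tcoef_sum (ltn0Sn n) u).
by apply: eq_bigr => j _; rewrite -!tensor_mx_row0 etu.
Qed.

Lemma matrix_twistE c a : matrix_twist (c \ox a) = twist_fun c a.
Proof. exact: tlift_tens. Qed.

Lemma tcoef_twist_fun c a (j : 'I_n.+1) :
  tcoef n.+1 A j (twist_fun c a) = (psi c * phi a) 0 j.
Proof.
rewrite linear_sum (bigD1 j) //= tcoefE truncpolyXn // coefXn eqxx scale1r.
rewrite big1 ?addr0 // => l nel; rewrite tcoefE truncpolyXn // coefXn eq_sym.
by rewrite val_eqE (negPf nel) scale0r.
Qed.

Lemma defect_psi_mul c X : defect phi X = 0 -> defect phi (psi c * X) = 0.
Proof.
have [q ->] := truncpoly_gen c; rewrite (rmorph_mx_horner psi_alg) psi_qX.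
elim/poly_ind: q X => [|q e IH] X X0; first by rewrite rmorph0 mul0r raddf0.
rewrite mxeval_mulX mulrDl -mulrA raddfD /= IH ?add0r.
  by rewrite -phi_alg defect_phi_mul // X0 mulr0.
exact: defect_shift_mul_eq0.
Qed.

(** psi(c) phi(a) has zero defect, so it is determined by its row 0, and that
    row is how twist_fun is defined. *)
Lemma tensor_mx_twist c a :
  tensor_mx (matrix_twist (c \ox a)) = psi c * phi a.
Proof.
rewrite -[RHS](subr0) -[X in _ - X](defect_psi_mul c (defect_phi phi_row0 a)).
rewrite subKr matrix_twistE; apply: eq_bigr => j _.
by rewrite tcoef_twist_fun.
Qed.

Lemma matrix_twist_is_twisting : is_twisting matrix_twist.
Proof.
exact: (factorization_is_twisting (theta := tensor_mx) tensor_mx_tens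
  tensor_mx_inj tensor_mx_twist).
Qed.

Lemma gamma_matrix_twist (r : nat) (j : 'I_n.+1) a :
  gamma matrix_twist r j a = (shift ^+ r * phi a) 0 j.
Proof. by rewrite /gamma matrix_twistE tcoef_twist_fun rmorphXn psi_qX. Qed.
End TwistingFromMatrices.

(** * The matrices of an arbitrary twisting map *)

Section GammaMatrices.
Variables (k : comNzRingType) (A : comAlgType k) (n : nat).
Local Notation C := (truncpoly k n.+1).
Variable s : {linear tensor C A -> tensor A C}.
Hypothesis s_twisting : is_twisting s.
Implicit Types (a b : A) (c : C) (t : tensor A C).
Local Notation tcoef := (tcoef n.+1 A).

Definition gamma_mx a : 'M[A]_n.+1 := \matrix_(r, j) gamma s r j a.

Fact gamma_mx_is_zmod_morphism : zmod_morphism gamma_mx.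
Proof.
by move=> a b; apply/matrixP=> r j; rewrite !mxE /gamma linearBr !raddfB.
Qed.

Lemma gamma_mx_scalar (e : k) : gamma_mx e%:A = e%:A%:M.
Proof.
have [[_ s1] _ _] := s_twisting; apply/matrixP=> r j; rewrite !mxE /gamma.
rewrite linearZr_LR linearZ s1 /= linearZ tcoefE truncpolyXn // coefXn eq_sym.
by rewrite val_eqE scaler_nat scalerMnr.
Qed.

Lemma tcoef_mull j a t :
  tcoef j (tmap (tmul A) idfun (tassocV A A C (a \ox t))) = a * tcoef j t.
Proof.
elim/tensor_ind: t => [b c|t u IHt IHu].
  by rewrite tassocVE tmapE tmulE !tcoefE scalerAr.
by rewrite linearDr !linearD IHt IHu mulrDr.
Qed.

Lemma tcoef_twist j b t :
  tcoef j (tmap (tmul A) idfun (tassocV A A C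
    (tmap idfun s (tassoc A C A (t \ox b))))) =
  \sum_(l < n.+1) tcoef l t * gamma s l j b.
Proof.
elim/tensor_ind: t => [a c|t u IHt IHu]; last first.
  rewrite linearDl !linearD IHt IHu -big_split; apply: eq_bigr => l _.
  by rewrite linearD mulrDl.
rewrite tassocE tmapE tcoef_mull [c in LHS](truncpolyE (ltn0Sn n)).
rewrite linear_sumlz !linear_sum mulr_sumr; apply: eq_bigr => l _.
by rewrite tcoefE linearZl_LR !linearZ /= -scalerAr scalerAl.
Qed.

(** The third twisting axiom, read in the coordinate of y^j, is the formula
    for the entries of a matrix product. *)
Lemma gamma_mxM : {morph gamma_mx : a b / a * b}.
Proof.
move=> a b; apply/matrixP=> r j; rewrite !mxE; have [_ _ smul] := s_twisting.
have := smul ('qX ^+ r \ox a \ox b).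
rewrite /= tassocE !tmapE tmulE /gamma => ->.
by rewrite tcoef_twist; apply: eq_bigr => l _; rewrite !mxE.
Qed.

Fact gamma_mx_is_monoid_morphism : monoid_morphism gamma_mx.
Proof.
by split; [rewrite -[1]scale1r gamma_mx_scalar scale1r | apply: gamma_mxM].
Qed.

HB.instance Definition _ := GRing.isZmodMorphism.Build A 'M[A]_n.+1
  gamma_mx gamma_mx_is_zmod_morphism.
HB.instance Definition _ := GRing.isMonoidMorphism.Build A 'M[A]_n.+1
  gamma_mx gamma_mx_is_monoid_morphism.

Lemma gamma_mx_horner x q : gamma_mx (horner_alg x q) = mxeval (gamma_mx x) q.
Proof. exact: (rmorph_mx_horner gamma_mx_scalar). Qed.

Lemma gamma_mx_row0 a j : gamma_mx a 0 j = a *+ (j == 0).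
Proof.
have [[s1 _] _ _] := s_twisting; rewrite mxE /gamma s1 tcoefE.
by rewrite -[1]/('qX ^+ 0) truncpolyXn // coefXn -scaler_nat.
Qed.

Lemma tcoef_mulr (j : 'I_n.+1) i t :
  tcoef j (tmap idfun (tmul C) (tassoc A C C (t \ox 'qX ^+ i))) =
  if (i <= j)%N then tcoef (j - i) t else 0.
Proof.
elim/tensor_ind: t => [b c|t u IHt IHu].
  rewrite tassocE tmapE tmulE !tcoefE coef_mul_qX //.
  by case: ifP; rewrite ?scale0r.
by rewrite linearDl !linearD IHt IHu; case: ifP; rewrite ?addr0.
Qed.

Lemma tcoef_twist_qX (r : nat) (j : 'I_n.+1) t :
  tcoef j (tmap idfun (tmul C) (tassoc A C C
    (tmap s idfun (tassocV C A C ('qX ^+ r \ox t))))) =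
  \sum_(i < n.+1) if (i <= j)%N then gamma s r (j - i) (tcoef i t) else 0.
Proof.
elim/tensor_ind: t => [b c|t u IHt IHu]; last first.
  rewrite linearDr !linearD IHt IHu -big_split; apply: eq_bigr => i _.
  by case: ifP; rewrite /= ?addr0 // /gamma linearD linearDr !linearD.
rewrite tassocVE tmapE [c in LHS](truncpolyE (ltn0Sn n)).
rewrite linear_sumr !linear_sum; apply: eq_bigr => i _ /=.
rewrite tcoefE linearZr_LR !linearZ /= tcoef_mulr.
by case: ifP => _; rewrite ?scaler0 // /gamma linearZr_LR !linearZ.
Qed.

Lemma gammaS (r : nat) (j : 'I_n.+1) a : gamma s r.+1 j a =
  \sum_(i < n.+1) if (i <= j)%N then gamma s r (j - i) (gamma s 1 i a) else 0.
Proof.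
have [_ smul _] := s_twisting; have := smul ('qX ^+ r \ox 'qX \ox a).
rewrite /= tassocE !tmapE tmulE -exprSr [gamma s r.+1 j a]/gamma => ->.
by rewrite tcoef_twist_qX.
Qed.

Hypothesis s_upper : upper_triangular s.

(** The second twisting axiom for y^r * y, one matrix row for each r.  In the
    last row both sides vanish, as y^n = 0.  Upper triangularity of s removes
    the term l = 0, which is what makes the relation solvable column by
    column. *)
Lemma shift_gamma_mx a : shift * gamma_mx a =
  \sum_(1 <= l < n.+1) gamma_mx (gamma s 1 l a) * shift ^+ l.
Proof.
apply/matrixP=> r j; rewrite shift_mulE summxE.
transitivity (gamma s r.+1 j a).
  case: ltnP => [ltr|ger]; first by rewrite mxE inordK.
  by rewrite gamma_ge.
rewrite gammaS -(big_mkord xpredT (fun i =>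
  if (i <= j)%N then gamma s r (j - i) (gamma s 1 i a) else 0)).
rewrite big_ltn // s_upper [gamma s r _ 0]/gamma linear0r !raddf0 /= add0r.
apply: eq_big_nat => l _; rewrite mul_shiftXE; case: ifP => // lej.
by rewrite mxE inordK // (leq_ltn_trans (leq_subr _ _)).
Qed.
End GammaMatrices.

(** * Existence and uniqueness *)

Theorem theorem4p18 (k : comNzRingType) (m n : nat)
    (m_gt0 : (0 < m)%N) (n_gt0 : (0 < n)%N)
    (P : nat -> truncpoly k m)
    (x_dvd_P : forall j : nat, (0 < j < n)%N ->
       exists Q : truncpoly k m, P j = 'qX * Q) :
  exists s : {linear tensor (truncpoly k n) (truncpoly k m) ->
                     tensor (truncpoly k m) (truncpoly k n)},
    [/\ is_twisting s,
        upper_triangular s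
      & forall j : nat, (0 < j < n)%N -> gamma s 1 j 'qX = P j] /\
    forall s' : {linear tensor (truncpoly k n) (truncpoly k m) ->
                        tensor (truncpoly k m) (truncpoly k n)},
      [/\ is_twisting s',
          upper_triangular s'
        & forall j : nat, (0 < j < n)%N -> gamma s' 1 j 'qX = P j] ->
      s' =1 s.
Proof.
case: n n_gt0 x_dvd_P => // n _ x_dvd_P.
pose p l : {poly k} := P l.
pose M := twistmx n ('qX : truncpoly k m) p.
have p0 l : (0 < l < n.+1)%N -> (p l)`_0 = 0.
  by move=> /x_dvd_P[Q ePQ]; rewrite /p ePQ mulrC -['qX]expr1 coef_mul_qX.
(* Applied twice at the end: once to the map constructed below and once to an
   arbitrary competitor s'. *)
have gamma_mxE s : [/\ is_twisting s, upper_triangular s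
    & forall j : nat, (0 < j < n.+1)%N -> gamma s 1 j 'qX = P j] ->
    forall a : truncpoly k m, gamma_mx s a = mxeval M (a : {poly k}).
  move=> [tw up g1] a; rewrite -{1}[a]truncpolyK (gamma_mx_horner tw).
  congr (mxeval _ _); apply: (@twist_step_fixed_unique _ _ _ 'qX p).
    apply: twist_step_fixed; first exact: gamma_mx_row0.
    rewrite (shift_gamma_mx tw up); apply: eq_big_nat => l /g1 ->.
    by rewrite -{1}[P l]truncpolyK (gamma_mx_horner tw).
  exact: twistmx_fixed.
have [phi [phi_alg phi_qX]] :
  exists f : {rmorphism truncpoly k m -> 'M[truncpoly k m]_n.+1},
    (forall c : k, f c%:A = c%:A%:M) /\ f 'qX = M.
  apply: truncpoly_rmorphism_exists => //; apply: twistmx_nilpotent => //.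
  exact: truncpolyXn_eq0.
have phiE a : phi a = mxeval M (a : {poly k}).
  by rewrite -{1}[a]truncpolyK (rmorph_mx_horner phi_alg) phi_qX.
have phi_row0 a j : phi a 0 j = a *+ (j == 0).
  by rewrite phiE (mxeval_row0 _ (twistmx_row0 _ _)) truncpolyK.
have phi_upper a : upper 0 (phi a).
  by rewrite phiE; apply/upper_mxeval/upper_twistmx.
have [psi [psi_alg psi_qX]] :=
  truncpoly_rmorphism_exists (ltn0Sn n) (shiftX_eq0 (truncpoly k m) n).
have shift_phi_qX :
  shift * phi 'qX = \sum_(1 <= l < n.+1) phi (P l) * shift ^+ l.
  by rewrite phi_qX shift_twistmx; apply: eq_big_nat => l _; rewrite phiE.
have shift_phi a : defect phi (shift * phi a) = 0.
  exact (defect_shift_phi phi_row0 phi_upper phi_alg (@truncpoly_gen k m)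
    shift_phi_qX a).
pose s := matrix_twist phi_alg psi_alg.
have s_ok : [/\ is_twisting s, upper_triangular s
    & forall j : nat, (0 < j < n.+1)%N -> gamma s 1 j 'qX = P j].
  split; first exact: matrix_twist_is_twisting.
    move=> a; rewrite (gamma_matrix_twist phi_alg psi_alg psi_qX 1 0).
    by rewrite expr1 (upperM (@upper_shift _ n) (phi_upper a)).
  (* Row 0 of N phi(x) = sum_l phi(P_l) N^l is (0, P_1, P_2, ..). *)
  move=> j /andP[j_gt0 ltj].
  rewrite (gamma_matrix_twist phi_alg psi_alg psi_qX 1 (Ordinal ltj)) expr1.
  rewrite shift_phi_qX summxE.
  rewrite (bigD1_seq j) ?mem_index_iota ?j_gt0 ?iota_uniq //=.
  rewrite phi_shiftX_row0 // eqxx big1 ?addr0 // => l nel.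
  by rewrite phi_shiftX_row0 //= (negPf nel).
exists s; split=> // s' s'_ok; apply: tensor_ext => c a.
rewrite [c](truncpolyE (ltn0Sn n)) linear_sumlz !linear_sum.
apply: eq_bigr => r _.
rewrite !linearZl_LR !linearZ !gammaE //; congr (_ *: _); apply: eq_bigr => j _.
congr (_ \ox _).
have := congr1 (fun X : 'M_n.+1 => X r j) (gamma_mxE _ s'_ok a).
by rewrite -(gamma_mxE _ s_ok) !mxE.
Qed.
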